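(* Let $c=\frac{1+\sqrt{2}}{2}$ and fix a real number $\varepsilon$ with $0<\varepsilon<c$. There exists an integer $q_0$ (depending on $\varepsilon$) such that for every integer $q\geq q_0$ there exist infinitely many $K_q$-divisible graphs $G$ with minimum degree $\delta(G)\geq \left(1-\frac{1}{(c-\varepsilon)\cdot (q+1)}\right)v(G)$ such that $G$ has no $K_q$-decomposition and even no fractional $K_q$-decomposition.
   Context: Graphs are finite, simple and undirected, and ''infinitely many'' is understood up to isomorphism. For a graph $G$, $v(G)$ and $e(G)$ denote its numbers of vertices and edges, $d_G(x)$ the degree of a vertex $x$, and $\delta(G)$ the minimum degree. A graph $G$ is $K_q$-divisible if $\binom{q}{2}$ divides $e(G)$ and $q-1$ divides $d_G(x)$ for every vertex $x\in V(G)$. A $K_q$-decomposition of $G$ is a partition of the edge set of $G$ into (edge sets of) edge-disjoint copies of $K_q$ in $G$. A fractional $K_q$-decomposition of $G$ is an assignment of non-negative real weights to the copies of $K_q$ in $G$ such that for every edge $e$ of $G$, the total weight of the copies of $K_q$ containing $e$ is exactly $1$. *)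

(* Defs.v *)
From HB Require Import structures.
From mathcomp Require Import all_boot all_order all_algebra.
From mathcomp Require Import reals.

Set Implicit Arguments.
Unset Strict Implicit.
Unset Printing Implicit Defensive.

Import Order.TTheory GRing.Theory Num.Theory.

Local Open Scope ring_scope.

Record sgraph := SGraph {
  vertex :> finType;
  adj : rel vertex;
  adj_sym : symmetric adj;
  adj_irr : irreflexive adj }.

Definition isomorphic (G H : sgraph) : Prop :=
  exists2 f : G -> H, bijective f & forall x y, adj (f x) (f y) = adj x y.

Definition infinitely_many_up_to_iso (P : sgraph -> Prop) : Prop :=
  exists2 F : nat -> sgraph,
    forall i, P (F i) & forall i j, i <> j -> ~ isomorphic (F i) (F j).

Section GraphNotions.
Variable G : sgraph.

Definition nb_vertices : nat := #|G|.

Definition edges : {set {set G}} :=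
  [set e | [exists x, exists y, adj x y && (e == [set x; y])]].

Definition nb_edges : nat := #|edges|.

Definition degree (x : G) : nat := #|[set y | adj x y]|.

(* Every degree is smaller than #|G|, so the default value #|G| only matters
   for the graph without vertices, whose minimum degree is thus 0. *)
Definition min_degree : nat := \big[minn/#|G|]_(x : G) degree x.

Definition Kq_divisible (q : nat) : Prop :=
  ('C(q, 2) %| nb_edges)%N /\ forall x : G, (q.-1 %| degree x)%N.

Definition pairs_of (S : {set G}) : {set {set G}} :=
  [set e : {set G} | (#|e| == 2)%N && (e \subset S)].

(* A copy of K_q is represented by its vertex set S; its edge set is
   [pairs_of S]. *)
Definition Kq_copy (q : nat) (S : {set G}) : bool :=
  (#|S| == q)%N && (pairs_of S \subset edges).

Definition Kq_decomposition (q : nat) (P : {set {set {set G}}}) : Prop :=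
  partition P edges /\
  forall B, B \in P -> exists2 S, Kq_copy q S & B = pairs_of S.

Definition fractional_Kq_decomposition (R : realType) (q : nat)
    (w : {set G} -> R) : Prop :=
  (forall S, Kq_copy q S -> 0 <= w S) /\
  forall e, e \in edges ->
    \sum_(S : {set G} | Kq_copy q S && (e \in pairs_of S)) w S = 1.

End GraphNotions.

(* Main.v *)
(** Let B induce a d-regular graph in G, all other pairs of vertices being
    edges of G, and give an edge of G the weight (q-1)(q-2), -(q-2) or 2
    according to whether 2, 1 or 0 of its ends lie in B.  A copy of K_q with a
    vertices in B then has weight (q(q-1)/2)(a-1)(a-2), which is nonnegative
    because a is an integer, so a fractional K_q-decomposition would force the
    total weight of G to be nonnegative too.  When B has x n/q vertices and
    d = y n/q, with n = v(G), this total is about (1 - x + xy/2) n^2, whereas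
    the missing degree is (x - y) n/q.  The total is negative once x(2-y) > 2,
    and under that constraint the least x - y is 2(sqrt 2 - 1) = 1/c, attained
    in the limit x = sqrt 2, y = 2 - sqrt 2. *)
Require Import Defs.
From mathcomp Require Import all_boot all_order all_algebra.
From mathcomp Require Import reals.
From mathcomp Require Import ring lra zify.

Import Order.TTheory GRing.Theory Num.Theory.

Set Implicit Arguments.
Unset Strict Implicit.
Unset Printing Implicit Defensive.

Local Open Scope ring_scope.

(** * Numerical estimates and choice of parameters *)

(* Below [r], [s] and [m] stand for [sqrt 2], a slack and a scale, so that [b]
   is nearly [r * m] and [e] nearly [(2 - r - s) * m / q]. *)
Lemma sparse_estimate (R : realFieldType) (c g q r s m b e : R) :
  0 < c -> c * g = 1 -> r < 3 / 2 -> 0 < s <= 1 / 20 ->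
  2 * (r - 1) + 2 * s <= g -> 10 <= q * s -> 3 <= q ->
  4 * (q * (q - 1) + 1) <= m * s -> 0 < m -> 0 <= b -> b <= r * m ->
  (2 - r - s) * m < (e + 1) * q ->
  c * (q + 1) * ((q - 1) * b + 1 - q * (q - 1) * e)
    <= q * (q - 1) * m + ((q - 1) * b + 1).
Proof.
move=> c_gt0 cg r_lt /andP[s_gt0 s_le] sg q_s q_ge3 m_s m_gt0 b_ge0 b_le e_gt.
have q1_ge0 : 0 <= q - 1 by lra.
(* The leading coefficient is [2 * (r - 1) + s]; rounding [e] and the final 1 cost at most
   [q * (q - 1) + 1], which fits into [(q - 1) * m * s / 8]. *)
have sparse : (q - 1) * b + 1 - q * (q - 1) * e
              <= (q - 1) * m * (2 * (r - 1) + 9 / 8 * s).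
  have hE := ler_wpM2l q1_ge0 (ltW e_gt).
  have hb := ler_wpM2l q1_ge0 b_le.
  have hs : 0 <= (q - 3) * (m * s) by rewrite !mulr_ge0 //; lra.
  lra.
(* The unspent [7 / 8 * s] pays for replacing [q] by [q + 1], because [q * s] is at least 10. *)
have rate : (q + 1) * (2 * (r - 1) + 9 / 8 * s) <= q * g.
  have /(ler_wpM2l (_ : 0 <= q)) := sg; lra.
have cq_ge0 : 0 <= c * (q + 1) by rewrite mulr_ge0 //; lra.
apply: (@le_trans _ _ (q * (q - 1) * m)); last first.
  by rewrite lerDl addr_ge0 // mulr_ge0.
apply: le_trans (ler_wpM2l cq_ge0 sparse) _.
have -> : q * (q - 1) * m = c * (q - 1) * m * (q * g).
  by rewrite -[LHS]mul1r -cg; ring.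
have -> : c * (q + 1) * ((q - 1) * m * (2 * (r - 1) + 9 / 8 * s)) =
  c * (q - 1) * m * ((q + 1) * (2 * (r - 1) + 9 / 8 * s)) by ring.
by rewrite ler_wpM2l // !mulr_ge0 // ltW.
Qed.

(** With N = q(q-1)m, the second factor is at most -N(r+s), and (q-1)b+1 is nearly (q-1)rm. Since
    r(r+s) = 2+rs, the sign is that of 2q - (q-2)(2+rs) up to rounding, and this is negative because
    qs is large. *)
Lemma negative_estimate (R : realFieldType) (q r s m b e : R) :
  r * r = 2 -> 7 / 5 < r < 3 / 2 -> 0 < s <= 1 / 20 -> 10 <= q * s -> 3 <= q ->
  4 * (q * (q - 1) + 1) <= m * s -> 0 < m -> r * m < b + 1 -> 0 <= e ->
  e * q <= (2 - r - s) * m ->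
  (q - 2) * ((q - 1) * b + 1)
    * ((q - 1) * (q * (q - 1) * e) - 2 * (q * (q - 1) * m))
  + 2 * (q * (q - 1) * m) * (q * (q - 1) * m - 1) < 0.
Proof.
move=> r2 /andP[r_gt r_lt] /andP[s_gt0 s_le] q_s q_ge3 m_s m_gt0 b_gt e_ge0 e_le.
have q1_gt0 : 0 < q - 1 by lra.
have N_gt0 : 0 < q * (q - 1) * m by rewrite !mulr_gt0 //; lra.
have inner : (q - 1) * (q * (q - 1) * e) - 2 * (q * (q - 1) * m)
             <= - (q * (q - 1) * m * (r + s)).
  have e_le' : (q - 1) * e <= (2 - r - s) * m by lra.
  have q'_ge0 : 0 <= q * (q - 1) by rewrite mulr_ge0 //; lra.
  have := ler_wpM2l q'_ge0 e_le'; lra.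
have outer : 2 * q * m < (q - 2) * ((r * m - 1) * (r + s)).
  have ms_ge : 28 <= m * s by nra.
  have h1 : (2 + s / 2) * m <= (r * m - 1) * (r + s).
    have h : 0 <= (r - 7 / 5) * (m * s) by rewrite !mulr_ge0 //; lra.
    have h' : r * r * m = 2 * m by rewrite r2.
    lra.
  have h2 : 2 * q < (q - 2) * (2 + s / 2) by lra.
  have q2_ge0 : 0 <= q - 2 by lra.
  have := ler_wpM2l q2_ge0 h1.
  have : 2 * q * m < (q - 2) * (2 + s / 2) * m by rewrite ltr_pM2r.
  lra.
have b'_ge : (q - 1) * (r * m - 1) <= (q - 1) * b + 1.
  by have := ltr_pM2l q1_gt0 (r * m - 1) b; rewrite ltrBlDr b_gt; lra.
move: inner N_gt0; set N := q * (q - 1) * m => inner N_gt0.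
have b''_ge0 : 0 <= (q - 2) * ((q - 1) * b + 1).
  rewrite mulr_ge0 //; first lra.
  by apply: le_trans b'_ge; rewrite mulr_ge0 //; [lra | nra].
have h1 := ler_wpM2l b''_ge0 inner.
have c_ge0 : 0 <= N * (r + s) * (q - 2) by rewrite !mulr_ge0 //; lra.
have h2 := ler_wpM2l c_ge0 b'_ge.
have h3 : N * (q - 1) * (2 * q * m)
          < N * (q - 1) * ((q - 2) * ((r * m - 1) * (r + s))).
  by rewrite ltr_pM2l // mulr_gt0.
have h4 : N * (q - 1) * (2 * q * m) = 2 * N * N by rewrite /N; ring.
lra.
Qed.

(* The graph has m vertices outside B, with |B| = b: that q(q-1) divides m and d
   and that b = 1 modulo q-1 is what makes it K_q-divisible. *)
Lemma counterexample_parameters (R : realType) (c : R) :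
  0 < c -> c < (1 + Num.sqrt 2) / 2 ->
  exists q0 : nat, forall q : nat, (q0 <= q)%N ->
    (2 < q)%N /\
    exists M beta E : nat -> nat,
      {homo (fun i => q * q.-1 * M i + (q.-1 * beta i).+1)%N :
         i j / (i < j)%N} /\
      forall i,
      let m := (q * q.-1 * M i)%N in let b := (q.-1 * beta i).+1 in
      let d := (q * q.-1 * E i)%N in
      [/\ (d < b)%N, c * (q%:R + 1) * (b%:R - d%:R) <= m%:R + b%:R :> R
        & (q%:R - 2) * b%:R * ((q%:R - 1) * d%:R - 2 * m%:R)
          + 2 * m%:R * (m%:R - 1) < 0 :> R].
Proof.
move=> c_gt0 c_lt; set r := Num.sqrt 2 in c_lt.
have r2 : r * r = 2 by rewrite -expr2 sqr_sqrtr.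
have r_ge0 : 0 <= r by apply: sqrtr_ge0.
have r_lt : r < 3 / 2 by nra.
have r_gt : 7 / 5 < r by nra.
pose g := c^-1; have cg : c * g = 1 by rewrite /g mulfV ?gt_eqF.
have g_gt0 : 0 < g by rewrite invr_gt0.
(* As (r+1)(r-1) = 1, the number 2(r-1) is the inverse of (1+r)/2, which exceeds [c]. *)
have g_gt : 2 * (r - 1) < g by nra.
have [s [s_gt0 s_le sg]] : exists s, [/\ 0 < s, s <= 1 / 20
    & 2 * (r - 1) + 2 * s <= g].
  exists (Num.min ((g - 2 * (r - 1)) / 2) (1 / 20)); split.
  - by rewrite lt_min; apply/andP; split; lra.
  - by rewrite ge_min lexx orbT.
  - have : Num.min ((g - 2 * (r - 1)) / 2) (1 / 20) <= (g - 2 * (r - 1)) / 2.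
      by rewrite ge_min lexx.
    by lra.
have large x : exists n0, forall n, (n0 <= n)%N -> x <= n%:R :> R.
  exists (Num.truncn x).+1 => n le_n; apply/ltW/(lt_le_trans (truncnS_gt x)).
  by rewrite ler_nat.
have [q0 Hq0] := large (10 / s); exists (maxn q0 3) => q.
rewrite geq_max => /andP[/Hq0 q_s q_gt2]; split=> //.
have {}q_s : 10 <= q%:R * s by rewrite -ler_pdivrMr.
have q_gt0 : (0 < q)%N by apply: leq_trans q_gt2.
have q1_gt0 : (0 < q.-1)%N by rewrite -ltnS prednK // ltnW.
have qE : q.-1%:R = q%:R - 1 :> R by rewrite -subn1 natrB.
have q_ge3 : 3 <= q%:R :> R by rewrite ler_nat.
have [M0 HM0] := large (4 * (q%:R * (q%:R - 1) + 1) / s).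
(* These are the limit ratios x = r and y = 2 - r of the optimum, with y lowered by [s] to make the
   total weight strictly negative; [M0] is large enough for the rounding to be harmless. *)
exists (fun i => M0 + i)%N, (fun i => Num.truncn (r * (M0 + i)%:R)),
       (fun i => Num.truncn ((2 - r - s) * (M0 + i)%:R / q%:R)); split.
  move=> i j lt_ij; rewrite -addSn leq_add //.
    by rewrite ltn_pmul2l ?ltn_add2l // muln_gt0 q_gt0.
  rewrite ltnS leq_mul2l le_truncn ?orbT // ler_wpM2l // ler_nat.
  by rewrite leq_add2l ltnW.
move=> i; have := HM0 _ (leq_addr i M0).
set M := (M0 + i)%N; set beta := Num.truncn _; set E := Num.truncn _ => Ms /=.
have {}Ms : 4 * (q%:R * (q%:R - 1) + 1) <= M%:R * s by rewrite -ler_pdivrMr.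
have M_gt0 : 0 < M%:R :> R by nra.
have /andP[] : beta%:R <= r * M%:R < beta.+1%:R.
  by rewrite truncn_itv // mulr_ge0.
rewrite -(natr1 beta) => beta_le beta_gt.
have /andP[] : E%:R <= (2 - r - s) * M%:R / q%:R < E.+1%:R.
  by rewrite truncn_itv // divr_ge0 ?mulr_ge0 //; lra.
rewrite -(natr1 E) ler_pdivlMr ?ltr_pdivrMr; [|lra|lra] => E_le E_gt.
(* Here 2 - r - s < r, so q * E < r * M < beta + 1; this yields d < b. *)
have le_Ebeta : (q * E <= beta)%N.
  by rewrite -ltnS -(ltr_nat R) natrM -(natr1 beta); nra.
rewrite -(natr1 (q.-1 * beta)) !natrM qE; split.
- by rewrite ltnS mulnAC mulnC leq_mul2l le_Ebeta orbT.
- by apply: (@sparse_estimate _ _ g _ r s) => //; rewrite ?s_gt0 ?ler0n.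
- by apply: (@negative_estimate _ _ r s) => //; rewrite ?s_gt0 ?r_gt ?ler0n.
Qed.

(** * Sums over edges by double counting *)

(** Each edge comes from exactly two ordered pairs, distinct by irreflexivity. Doubling avoids
    division, so that the same identity serves natural-number counts and real weights. *)
Lemma sum_unordered_pairs (T : finType) (V : nmodType) (r : rel T)
    (Y : {set T} -> V) : symmetric r -> irreflexive r ->
  (\sum_(e in [set e : {set T} |
                [exists x, exists y, r x y && (e == [set x; y])]]) Y e) *+ 2
  = \sum_x \sum_(y | r x y) Y [set x; y].
Proof.
move=> r_sym r_irr; set E := [set _ | _].
rewrite pair_big_dep /=.
rewrite (partition_big (fun p : T * T => [set p.1; p.2]) (mem E)) /=; last first.
  case=> x y /= rxy; rewrite inE; apply/existsP; exists x.
  by apply/existsP; exists y; rewrite rxy eqxx.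
rewrite -sumrMnl; apply: eq_bigr => e.
rewrite inE => /existsP[x /existsP[y /andP[rxy /eqP->]]].
have neq_xy : x != y by apply: contraTneq rxy => ->; rewrite r_irr.
rewrite (bigD1 (x, y)) ?rxy ?eqxx //= (bigD1 (y, x)) /=; last first.
  by rewrite r_sym rxy setUC eqxx /= xpair_eqE eq_sym negb_and neq_xy.
rewrite big1 ?addr0 ?[[set y; x]]setUC // => -[u v] /=.
rewrite !xpair_eqE -!andbA => /and4P[ruv /eqP Euv nxy nyx]; exfalso.
have neq_uv : u != v by apply: contraTneq ruv => ->; rewrite r_irr.
have: u \in [set x; y] by rewrite -Euv !inE eqxx.
have: v \in [set x; y] by rewrite -Euv !inE eqxx orbT.
rewrite !inE => /orP[]/eqP ev /orP[]/eqP eu; subst u v;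
  by rewrite ?eqxx in neq_uv nxy nyx.
Qed.

Lemma sum_edges (G : sgraph) (V : nmodType) (Y : {set G} -> V) :
  (\sum_(e in edges G) Y e) *+ 2 = \sum_x \sum_(y | adj x y) Y [set x; y].
Proof. exact: sum_unordered_pairs (@adj_sym G) (@adj_irr G). Qed.

Lemma sum_pairs_of (G : sgraph) (V : nmodType) (S : {set G}) (Y : {set G} -> V) :
  (\sum_(e in pairs_of S) Y e) *+ 2 =
  \sum_(x in S) \sum_(y in S :\ x) Y [set x; y].
Proof.
(* [pairs_of S] is the edge set of the complete graph on [S], whatever the adjacency of [G]. *)
pose r := [rel x y : G | [&& x \in S, y \in S & y != x]].
have rS : symmetric r by move=> x y; rewrite /r /= andbCA eq_sym.
have rI : irreflexive r by move=> x; rewrite /r /= eqxx !andbF.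
have -> : pairs_of S =
    [set e | [exists x, exists y, r x y && (e == [set x; y])]].
  apply/setP=> e; rewrite !inE; apply/andP/existsP.
    case=> /cards2P[x [y [nxy ->]]]; rewrite subUset !sub1set => /andP[xS yS].
    by exists x; apply/existsP; exists y; rewrite /r /= xS yS eq_sym nxy eqxx.
  case=> x /existsP[y /andP[/and3P[xS yS nyx] /eqP->]].
  by rewrite cards2 (eq_sym x) nyx subUset !sub1set xS yS.
rewrite sum_unordered_pairs // [RHS]big_mkcond; apply: eq_bigr => x _.
rewrite /r /=; case: (x \in S); last by rewrite big_pred0.
by apply: eq_bigl => y; rewrite !inE /= andbC.
Qed.

Lemma sum_degree (G : sgraph) : (\sum_(x : G) degree x = nb_edges G * 2)%N.
Proof.
rewrite /nb_edges -sum1_card muln2 -addnn.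
apply/esym/(etrans (@sum_edges G nat (fun=> 1%N))).
by apply: eq_bigr => x _; rewrite /degree cardsE; apply: sum1_card.
Qed.

(** * Fractional decompositions and weak duality *)

(** Once [S1] has two vertices, each of its vertices lies on a pair; hence a copy of K_q is
    determined by its edge set when q > 1. *)
Lemma pairs_of_subset (G : sgraph) (S1 S2 : {set G}) :
  (1 < #|S1|)%N -> pairs_of S1 \subset pairs_of S2 -> S1 \subset S2.
Proof.
move=> S1_gt1 /subsetP sS12; apply/subsetP=> x xS1.
have /card_gt0P[y] : (0 < #|S1 :\ x|)%N by move: S1_gt1; rewrite (cardsD1 x) xS1.
rewrite !inE => /andP[nyx yS1].
have: [set x; y] \in pairs_of S1.
  by rewrite inE cards2 (eq_sym x) nyx subUset !sub1set xS1 yS1.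
by move/sS12; rewrite inE subUset !sub1set => /and3P[].
Qed.

(** An edge lies in a single block and the block determines its copy, so the indicator weights on
    copies add up to 1 at each edge. *)
Lemma decomposition_fractional (R : realType) (G : sgraph) (q : nat)
    (P : {set {set {set G}}}) : (1 < q)%N -> Kq_decomposition q P ->
  fractional_Kq_decomposition q (fun S => (pairs_of S \in P)%:R : R).
Proof.
move=> q_gt1 [/and3P[/eqP coverP trivP _] copyP]; split=> [S _|e eE].
  exact: ler0n.
have /bigcupP[B BP eB] : e \in cover P by rewrite coverP.
have [S Scopy defB] := copyP B BP.
rewrite (bigD1 S) /= ?Scopy -?defB ?BP // big1 ?addr0 // => S'.
rewrite -andbA => /and3P[S'copy eS' nS'].
apply/eqP; rewrite pnatr_eq0 eqb0; apply: contra nS' => S'P.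
have eqB : pairs_of S' = B.
  by rewrite -(def_pblock trivP S'P eS') (def_pblock trivP BP eB).
have cS : #|S| = q by case/andP: Scopy => /eqP.
have cS' : #|S'| = q by case/andP: S'copy => /eqP.
by rewrite eqEsubset !pairs_of_subset ?cS ?cS' // eqB defB.
Qed.

(** Weak linear programming duality: exchanging the sums writes the total of [Y] as the [w]-weighted
    sum of its totals on the copies. *)
Lemma fractional_sum_ge0 (R : realType) (G : sgraph) (q : nat)
    (w Y : {set G} -> R) : fractional_Kq_decomposition q w ->
  (forall S, Kq_copy q S -> 0 <= \sum_(e in pairs_of S) Y e) ->
  0 <= \sum_(e in edges G) Y e.
Proof.
move=> [w_ge0 w1] Y_ge0.
have -> : \sum_(e in edges G) Y e =
    \sum_(S | Kq_copy q S) w S * \sum_(e in pairs_of S) Y e.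
  under [RHS]eq_bigr => S Scopy do rewrite mulr_sumr.
  rewrite (exchange_big_dep (mem (edges G))) /=; last first.
    by move=> S e /andP[_ /subsetP]; apply.
  by apply: eq_bigr => e /w1 we; rewrite -mulr_suml we mul1r.
by apply: sumr_ge0 => S Scopy; rewrite mulr_ge0 ?w_ge0 ?Y_ge0.
Qed.

(** * Regular graphs of every even degree *)

Section Circulant.
Variables (n h : nat).
Hypothesis hn : (h.*2 <= n)%N.

(** The residues 1, ..., h and -1, ..., -h modulo n + 1; the bound on [h] keeps these two arcs
    disjoint. *)
Definition circulant_set : {set 'I_n.+1} :=
  [set k : 'I_n.+1 | (0 < k <= h)%N || (n - h < k)%N].

Definition circulant_adj : rel 'I_n.+1 := fun x y => y - x \in circulant_set.

Lemma circulant_sym : symmetric circulant_adj.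
Proof using hn.
suff: forall k : 'I_n.+1, k \in circulant_set -> - k \in circulant_set.
  by move=> H x y; apply/idP/idP => /H; rewrite opprB.
move=> k; rewrite !inE /=.
have k_lt := ltn_ord k.
have [->|k_gt0] := posnP k; first by rewrite subn0 modnn.
rewrite modn_small; lia.
Qed.

Lemma circulant_irr : irreflexive circulant_adj.
Proof using. by move=> x; rewrite /circulant_adj subrr inE. Qed.

Definition circulant := SGraph circulant_sym circulant_irr.

Lemma card_circulant_set : #|circulant_set| = h.*2.
Proof using hn.
have card_lt a : (a <= n.+1)%N -> #|[set k : 'I_n.+1 | (k < a)%N]| = a.
  move=> a_le; rewrite -sum1_card (eq_bigl (fun k : 'I_n.+1 => (k < a)%N)).
    by rewrite -(big_ord_widen _ (fun=> 1%N)) // sum1_card card_ord.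
  by move=> k; rewrite inE.
have -> : circulant_set = ([set k : 'I_n.+1 | (k < h.+1)%N] :\ 0)
                          :|: ~: [set k : 'I_n.+1 | (k < (n - h).+1)%N].
  by apply/setP=> k; rewrite !inE -val_eqE /= -leqNgt lt0n ltnS.
rewrite cardsU disjoint_setI0 ?cards0 ?subn0; last first.
  by apply/pred0P=> k; rewrite /= !inE; lia.
have := cardsC [set k : 'I_n.+1 | (k < (n - h).+1)%N].
have := cardsD1 0 [set k : 'I_n.+1 | (k < h.+1)%N].
rewrite !card_lt ?inE ?card_ord //=; try lia.
by move: #|_ :\ _| #|~: _| => u v; lia.
Qed.

Lemma degree_circulant (x : circulant) : degree x = h.*2.
Proof using.
pose z : 'I_n.+1 := x; rewrite -card_circulant_set.
(* The neighbourhood of a vertex is a translate of the connection set. *)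
transitivity #|[set z + k | k in circulant_set]|; last first.
  by rewrite card_imset //; apply: addrI.
congr #|pred_of_set _|; apply/setP => y; rewrite inE.
apply/idP/imsetP => [zy | [k kS ->]]; first by exists (y - z); rewrite // addrC subrK.
by rewrite /adj /= /circulant_adj addrC addKr.
Qed.

End Circulant.

(** * The join of a clique with a graph *)

Section JoinClique.
Variables (T : finType) (H : sgraph).

Definition join_clique_adj : rel (T + H) := fun u v =>
  match u, v with
  | inl x, inl y => x != y
  | inr x, inr y => adj x y
  | _, _ => true
  end.

Lemma join_clique_sym : symmetric join_clique_adj.
Proof using. by case=> x [] y //=; [rewrite eq_sym | rewrite adj_sym]. Qed.

Lemma join_clique_irr : irreflexive join_clique_adj.
Proof using. by case=> x /=; [rewrite eqxx | rewrite adj_irr]. Qed.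

Definition join_clique := SGraph join_clique_sym join_clique_irr.

Lemma nb_vertices_join_clique : nb_vertices join_clique = (#|T| + #|H|)%N.
Proof using. exact: card_sum. Qed.

Lemma degree_join_clique_l (x : T) :
  degree (inl x : join_clique) = (#|T|.-1 + #|H|)%N.
Proof using.
rewrite /degree cardsE -sum1_card big_sumType /= !sum1_card.
by congr (_ + _)%N; rewrite -(cardC1 x); apply: eq_card => y; rewrite !inE eq_sym.
Qed.

Lemma degree_join_clique_r (x : H) :
  degree (inr x : join_clique) = (#|T| + degree x)%N.
Proof using.
rewrite /degree cardsE -sum1_card big_sumType /= !sum1_card.
by congr (_ + _)%N; rewrite cardsE.
Qed.

(** This is the set B of the weighting. *)
Definition right_part : {set join_clique} := [set inr x | x : H].

Lemma mem_right_part_l (x : T) : ((inl x : join_clique) \in right_part) = false.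
Proof using. by apply/imsetP => -[]. Qed.

Lemma mem_right_part_r (x : H) : ((inr x : join_clique) \in right_part) = true.
Proof using. exact: imset_f. Qed.

End JoinClique.

(** * The edge weighting and its totals *)

Section Weights.
Variables (R : realType) (q : nat).

(** Indexed by the number of ends in B, so the default 0 is never read on an edge. The values make
    the weight of a clique, a quadratic in the number of its vertices in B, vanish exactly at 1 and
    2. *)
Definition pair_weight (k : nat) : R :=
  nth 0 [:: 2; - (q%:R - 2); (q%:R - 1) * (q%:R - 2)] k.

Definition edge_weight (T : finType) (B e : {set T}) : R :=
  pair_weight #|e :&: B|.

Lemma edge_weight_pair (T : finType) (B : {set T}) (x y : T) : x != y ->
  edge_weight B [set x; y] = pair_weight ((x \in B) + (y \in B)).
Proof using.
move=> nxy; congr pair_weight.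
rewrite -sum1_card; under eq_bigl do rewrite inE.
rewrite big_mkcondr big_setU1 ?inE // big_set1.
by case: (x \in B); case: (y \in B).
Qed.

Lemma sum_by_membership (T : finType) (A B : {set T}) (f : bool -> R) :
  \sum_(x in A) f (x \in B) =
  #|A :&: B|%:R * f true + #|A :\: B|%:R * f false.
Proof using.
rewrite (big_setID B) /= !mulr_natl -!sumr_const.
by congr (_ + _); apply: eq_bigr => x; rewrite !inE => /andP[]; 
  [move=> _ -> | move=> /negbTE ->].
Qed.

Lemma clique_weight (G : sgraph) (B S : {set G}) : Kq_copy q S ->
  (\sum_(e in pairs_of S) edge_weight B e) *+ 2 =
  q%:R * (q%:R - 1) * ((#|S :&: B|%:R - 1) * (#|S :&: B|%:R - 2)).
Proof using.
move=> /andP[/eqP cS _]; rewrite sum_pairs_of.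
have cSD : #|S :\: B|%:R = q%:R - #|S :&: B|%:R :> R.
  by rewrite -cS -(cardsID B S) natrD addrC addKr.
set a := #|S :&: B|%:R : R in cSD *.
pose f (i j : bool) := pair_weight (i + j).
(* [F] is the weight at a vertex of [S]: the sum over all of [S], minus the diagonal term
   [f i i]. *)
pose F (i : bool) := a * f i true + (q%:R - a) * f i false - f i i.
transitivity (\sum_(x in S) F (x \in B)); last first.
  by rewrite sum_by_membership cSD /F /f /pair_weight /=; ring.
apply: eq_bigr => x xS.
rewrite /F -cSD -(sum_by_membership S B (f (x \in B))) (big_setD1 x xS).
rewrite addrAC subrr add0r; apply: eq_bigr => y; rewrite !inE => /andP[nyx _].
by rewrite edge_weight_pair // eq_sym.
Qed.

Lemma left_weight (T : finType) (H : sgraph) (x : T) :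
  \sum_(y | adj (inl x : join_clique T H) y)
     edge_weight (right_part T H) [set inl x; y] =
  (#|T|%:R - 1) * 2 - #|H|%:R * (q%:R - 2).
Proof using.
have T_gt0 : (0 < #|T|)%N by apply/card_gt0P; exists x.
rewrite big_sumType /=; congr (_ + _).
  transitivity (\sum_(y in predC1 x) (2 : R)); last first.
    by rewrite sumr_const cardC1 -[2 *+ _]mulr_natl -subn1 natrB.
  apply: eq_big => [y | y nxy]; first by rewrite !inE eq_sym.
  by rewrite edge_weight_pair ?mem_right_part_l ?(inj_eq inl_inj).
transitivity (\sum_(y : H) (- (q%:R - 2) : R)); last first.
  by rewrite sumr_const -[LHS]mulr_natl mulrN.
by apply: eq_bigr => y _; rewrite edge_weight_pair ?mem_right_part_l ?mem_right_part_r.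
Qed.

Lemma right_weight (T : finType) (H : sgraph) (x : H) :
  \sum_(y | adj (inr x : join_clique T H) y)
     edge_weight (right_part T H) [set inr x; y] =
  (degree x)%:R * ((q%:R - 1) * (q%:R - 2)) - #|T|%:R * (q%:R - 2).
Proof using.
rewrite big_sumType /= addrC; congr (_ + _).
  transitivity (\sum_(y in [set y | adj x y]) ((q%:R - 1) * (q%:R - 2) : R)).
    apply: eq_big => [y | y xy]; first by rewrite inE.
    rewrite edge_weight_pair ?mem_right_part_r // (inj_eq inr_inj).
    by apply: contraTneq xy => ->; rewrite adj_irr.
  by rewrite sumr_const -[LHS]mulr_natl.
transitivity (\sum_(y : T) (- (q%:R - 2) : R)); last first.
  by rewrite sumr_const -[LHS]mulr_natl mulrN.
by apply: eq_bigr => y _; rewrite edge_weight_pair ?mem_right_part_l ?mem_right_part_r.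
Qed.

(** The total is gathered vertex by vertex; mixed edges are met from both sides, whence the factor 2
    before the inner [#|T|]. *)
Lemma join_clique_weight (T : finType) (H : sgraph) (d : nat) :
    (forall x : H, degree x = d) ->
  (\sum_(e in edges (join_clique T H)) edge_weight (right_part T H) e) *+ 2 =
  (q%:R - 2) * #|H|%:R * ((q%:R - 1) * d%:R - 2 * #|T|%:R)
  + 2 * #|T|%:R * (#|T|%:R - 1).
Proof using.
move=> Hreg; rewrite sum_edges big_sumType.
transitivity (\sum_(x : T) ((#|T|%:R - 1) * 2 - #|H|%:R * (q%:R - 2) : R) +
  \sum_(x : H) (d%:R * ((q%:R - 1) * (q%:R - 2)) - #|T|%:R * (q%:R - 2) : R)).
  congr (_ + _); apply: eq_bigr => x _; first exact: left_weight.
  by rewrite -(Hreg x); apply: right_weight.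
rewrite !sumr_const -[X in X + _ = _]mulr_natl -[X in _ + X = _]mulr_natl.
by move: (#|T|%:R) (#|H|%:R) (d%:R) => t h e; ring.
Qed.

End Weights.

(** * Properties of the join: no fractional decomposition, divisibility, minimum degree *)

Lemma no_fractional_join_clique (R : realType) (q : nat) (T : finType)
    (H : sgraph) (d : nat) :
  (forall x : H, degree x = d) ->
  (q%:R - 2) * #|H|%:R * ((q%:R - 1) * d%:R - 2 * #|T|%:R)
    + 2 * #|T|%:R * (#|T|%:R - 1) < 0 :> R ->
  ~ exists w : {set join_clique T H} -> R, fractional_Kq_decomposition q w.
Proof.
move=> Hreg neg [w w_frac].
suff : 0 <= \sum_(e in edges (join_clique T H))
               edge_weight R q (right_part T H) e.
  by rewrite -(@pmulrn_lge0 _ _ 2) // (join_clique_weight R q T Hreg) leNgt neg.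
apply: (fractional_sum_ge0 w_frac) => S Scopy.
rewrite -(@pmulrn_lge0 _ _ 2) // (clique_weight _ _ Scopy).
have qq_ge0 : 0 <= q%:R * (q%:R - 1) :> R.
  have [->|q_gt0] := posnP q; first by rewrite mul0r.
  by rewrite mulr_ge0 // subr_ge0 ler1n.
(* Integrality enters here: (a-1)(a-2) is negative only strictly between 1 and 2. *)
rewrite mulr_ge0 //; case: #|_| => [|[|a]]; rewrite ?subrr ?mul0r //; first lra.
by rewrite -addn2 natrD addrK mulr_ge0 // -addrA addr_ge0 //; lra.
Qed.

(** The bound on [nb_vertices] handles the initial value of the iterated minimum. *)
Lemma min_degree_ge (R : realType) (G : sgraph) (x : R) :
  x <= (nb_vertices G)%:R -> (forall u : G, x <= (degree u)%:R) ->
  x <= (min_degree G)%:R.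
Proof.
move=> x_le x_deg; rewrite /min_degree.
elim/big_ind: _ => // m n xm xn.
by rewrite /minn; case: ifP.
Qed.

Lemma isomorphic_nb_vertices (G H : sgraph) :
  isomorphic G H -> nb_vertices G = nb_vertices H.
Proof. by case=> f f_bij _; apply: bij_eq_card f_bij. Qed.

(** Since |H| is 1 modulo q-1, a clique vertex has degree |T| + (q-1)beta. In the degree sum, q(q-1)
    divides |T| and also every degree on the side of H. *)
Lemma join_clique_divisible (q M beta E : nat) (T : finType) (H : sgraph) :
  #|T| = (q * q.-1 * M)%N -> #|H| = (q.-1 * beta).+1 ->
  (forall x : H, degree x = q * q.-1 * E)%N ->
  Kq_divisible (join_clique T H) q.
Proof.
move=> cT cH Hreg; have dvd_qq k : (q.-1 %| q * q.-1 * k)%N.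
  by rewrite dvdn_mulr // dvdn_mull.
split=> [|[x|x]].
- have -> : ('C(q, 2) %| nb_edges (join_clique T H))%N =
            (q * q.-1 %| nb_edges (join_clique T H) * 2)%N.
    by rewrite -(dvdn_pmul2r (isT : 0 < 2)%N) (bin_ffact q 2) !ffactnS ffactn0 muln1.
  rewrite -sum_degree big_sumType /=.
  under eq_bigr do rewrite degree_join_clique_l.
  under [X in (_ + X)%N]eq_bigr do rewrite degree_join_clique_r Hreg.
  rewrite !sum_nat_const cT -mulnDr.
  by apply: dvdn_add; [do 2 apply: dvdn_mulr | apply: dvdn_mull; apply: dvdn_mulr].
- have T_gt0 : (0 < #|T|)%N by apply/card_gt0P; exists x.
  by rewrite degree_join_clique_l cH addnS -addSn prednK // cT dvdn_add // dvdn_mulr.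
- by rewrite degree_join_clique_r Hreg cT dvdn_add.
Qed.

(** Vertices of H miss |H| - d from the order n, which is at most n/t. Those of the clique miss only
    1, and 1 <= |H| - d. *)
Lemma join_clique_min_degree (R : realType) (t : R) (T : finType) (H : sgraph)
    (d : nat) : 0 < t -> (d < #|H|)%N -> (forall x : H, degree x = d) ->
  t * (#|H|%:R - d%:R) <= #|T|%:R + #|H|%:R ->
  (1 - 1 / t) * (nb_vertices (join_clique T H))%:R
    <= (min_degree (join_clique T H))%:R.
Proof.
move=> t_gt0 d_lt Hreg; rewrite -ler_pdivlMl // => gap.
have d_lt' : d%:R + 1 <= #|H|%:R :> R by rewrite natr1 ler_nat.
rewrite nb_vertices_join_clique natrD div1r mulrBl mul1r.
have gap1 : 1 <= t^-1 * (#|T|%:R + #|H|%:R) by lra.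
apply: min_degree_ge; first by rewrite nb_vertices_join_clique natrD; lra.
case=> x; last by rewrite degree_join_clique_r Hreg natrD; lra.
have T_gt0 : (0 < #|T|)%N by apply/card_gt0P; exists x.
rewrite degree_join_clique_l natrD.
have := natr1 (R := R) #|T|.-1; rewrite prednK //; lra.
Qed.

(** * Assembly of the infinite family *)

Theorem theorem1p4 (R : realType) (eps : R) :
  let c : R := (1 + Num.sqrt 2) / 2 in
  0 < eps -> eps < c ->
  exists q0 : nat, forall q : nat, (q0 <= q)%N ->
    infinitely_many_up_to_iso (fun G : sgraph =>
      [/\ Kq_divisible G q,
          (min_degree G)%:R >=
            (1 - 1 / ((c - eps) * (q%:R + 1))) * (nb_vertices G)%:R,
          ~ (exists P : {set {set {set G}}}, Kq_decomposition q P)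
        & ~ (exists w : {set G} -> R, fractional_Kq_decomposition q w)]).
Proof.
move=> c eps_gt0 eps_lt.
have [||q0 Hq0] := @counterexample_parameters R (c - eps); rewrite ?subr_gt0 ?gtrBl //.
exists q0 => q /Hq0[q_gt2 [M [beta [E [mono est]]]]].
pose m i := (q * q.-1 * M i)%N; pose d i := (q * q.-1 * E i)%N.
(* Circulants have even degree; q(q-1) is even, so d is an admissible one. *)
have d_even i : (d i)./2.*2 = d i.
  apply: even_halfK; rewrite /d !oddM; case: (q) q_gt2 => // k _ /=.
  by case: (odd k).
have d_le i : ((d i)./2.*2 <= q.-1 * beta i)%N.
  by rewrite d_even -ltnS; case: (est i).
pose H i := circulant (d_le i).
have Hreg i (x : H i) : degree x = d i by rewrite degree_circulant d_even.
exists (fun i => join_clique 'I_(m i) (H i)) => [i | i j nij].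
  have [d_lt deg_est weight_est] := est i.
  have no_frac : ~ exists w : {set join_clique 'I_(m i) (H i)} -> R,
      fractional_Kq_decomposition q w.
    by apply: (no_fractional_join_clique (Hreg i)); rewrite !card_ord.
  split=> //.
  - by apply: (@join_clique_divisible q (M i) (beta i) (E i));
      rewrite ?card_ord //; apply: Hreg.
  - apply: (join_clique_min_degree _ _ (Hreg i)); rewrite ?card_ord //.
    by rewrite mulr_gt0 ?subr_gt0 // ltr_wpDl.
  - move=> [P /(decomposition_fractional R (ltnW q_gt2)) P_frac].
    by apply: no_frac; exists (fun S => (pairs_of S \in P)%:R).
(* The orders m + b increase strictly with the index, so no two members are isomorphic. *)
move/isomorphic_nb_vertices; rewrite !nb_vertices_join_clique !card_ord => eq_n.
by move/eqP: nij; rewrite neq_ltn => /orP[] /mono; rewrite eq_n ltnn.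
Qed.
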